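(* Let $n \ge 1$ be an integer. The $5$-colour bipartite Ramsey number of the cycle $C_{2(n+1)}$ of order $2(n+1)$ is larger than $6.5n$, and likewise the $5$-colour bipartite Ramsey number of the path $P_{2(n+1)}$ of order $2(n+1)$ is larger than $6.5n$.
   Context: The $k$-colour bipartite Ramsey number of a bipartite graph $H$ is the least integer $N$ such that every $k$-edge-colouring of the complete bipartite graph $K_{N,N}$ contains a monochromatic copy of $H$. The order of a path or cycle is its number of vertices. *)

(* Defs.v *)
From mathcomp Require Import all_boot.

Set Implicit Arguments.
Unset Strict Implicit.
Unset Printing Implicit Defensive.

Record sgraph := SGraph {
  vertex :> finType;
  edge : rel vertex;
  edge_sym : symmetric edge;
  edge_irr : irreflexive edge }.

Definition bipartite (G : sgraph) : Prop :=
  exists side : G -> bool, forall x y : G, edge x y -> side x != side y.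

Record bigraph := BiGraph {
  graph_of :> sgraph;
  bigraph_bipartite : bipartite graph_of }.

(* The vertices of K_{N,N} are 'I_N + 'I_N. Its edges are the unordered pairs
   {inl a, inr b}, so they are indexed by 'I_N * 'I_N. *)
Definition edge_colouring (k N : nat) : finType := {ffun 'I_N * 'I_N -> 'I_k}.

Definition colour_class k N (c : edge_colouring k N) (i : 'I_k) :
    rel ('I_N + 'I_N) :=
  fun u v => match u, v with
    | inl a, inr b | inr b, inl a => c (a, b) == i
    | _, _ => false
    end.

(* A copy is a subgraph, not necessarily induced, and may use the two sides of
   K_{N,N} in either role. *)
Definition mono_copy (H : sgraph) k N (c : edge_colouring k N) (i : 'I_k)
    (f : {ffun H -> 'I_N + 'I_N}) : bool :=
  injectiveb f &&
  [forall x : H, forall y : H, edge x y ==> colour_class c i (f x) (f y)].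

Definition forces_mono (k : nat) (H : sgraph) (N : nat) : bool :=
  [forall c : edge_colouring k N,
    [exists i : 'I_k, exists f : {ffun H -> 'I_N + 'I_N}, mono_copy c i f]].

Lemma pigeonhole (A B : finType) (f : A -> B) (t : nat) :
  #|B| * t < #|A| -> exists b, t < #|[set a | f a == b]|.
Proof.
move=> ltBA; apply/existsP; apply: contraLR ltBA; rewrite negb_exists -leqNgt.
move=> /forallP le_t; rewrite -cardsT -sum1_card.
rewrite (partition_big f predT) //= -sum_nat_const.
apply: leq_sum => b _; rewrite sum1dep_card.
apply: leq_trans (_ : #|[set a | f a == b]| <= t).
  by apply: subset_leq_card; apply/subsetP => a; rewrite !inE.
by rewrite leqNgt le_t.
Qed.

Lemma inject_in (V T : finType) (S : {set T}) :
  #|V| <= #|S| -> exists2 g : V -> T, injective g & forall x, g x \in S.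
Proof.
move=> leVS; exists (fun x => enum_val (widen_ord leVS (enum_rank x))).
  move=> x y /enum_val_inj /(congr1 val) /= /ord_inj; exact: enum_rank_inj.
by move=> x; apply: enum_valP.
Qed.

Lemma bip_ramsey_exists (k : nat) (H : bigraph) :
  exists N, forces_mono k H N.
Proof.
have [side sideP] := bigraph_bipartite H.
pose t := #|H|; pose m := (k * t).+1; pose N := m + (k ^ m * t).+1.
have le_mN : m <= N by apply: leq_addr.
exists N; apply/forallP => c.
pose row (b : 'I_N) := [ffun a : 'I_m => c (widen_ord le_mN a, b)].
have [|p ltT] := @pigeonhole _ _ row t.
  by rewrite card_ffun !card_ord /N addnS ltnS leq_addl.
have [|i ltS] := @pigeonhole _ _ p t; first by rewrite !card_ord.
have [gR gR_inj gRP] := inject_in (ltnW ltT).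
have [gL gL_inj gLP] := inject_in (ltnW ltS).
have cE x y : c (widen_ord le_mN (gL x), gR y) == i.
  have := gRP y; rewrite inE => /eqP /ffunP /(_ (gL x)); rewrite ffunE => ->.
  by have := gLP x; rewrite inE.
apply/existsP; exists i; apply/existsP.
exists [ffun x => if side x then inl (widen_ord le_mN (gL x)) else inr (gR x)].
apply/andP; split.
  apply/injectiveP => x y; rewrite !ffunE.
  case: (side x); case: (side y) => // -[].
    by move=> /ord_inj /gL_inj.
  by move=> /gR_inj.
apply/forallP => x; apply/forallP => y; apply/implyP => /sideP.
by rewrite !ffunE; case: (side x); case: (side y) => //= _; apply: cE.
Qed.

Definition bip_ramsey (k : nat) (H : bigraph) : nat :=
  ex_minn (bip_ramsey_exists k H).

Definition path_rel (m : nat) : rel 'I_m :=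
  fun i j => (i.+1 == j :> nat) || (j.+1 == i :> nat).

(* i and j are consecutive modulo m; the conjunct i != j only matters for
   m = 1, and this is the usual cycle as soon as m >= 3. *)
Definition cycle_rel (m : nat) : rel 'I_m :=
  fun i j => (i != j) && ((j == i.+1 %% m :> nat) || (i == j.+1 %% m :> nat)).

Lemma path_sym m : symmetric (@path_rel m).
Proof. by move=> i j; rewrite /path_rel orbC. Qed.

Lemma path_irr m : irreflexive (@path_rel m).
Proof. by move=> i; rewrite /path_rel orbb gtn_eqF. Qed.

Lemma cycle_sym m : symmetric (@cycle_rel m).
Proof. by move=> i j; rewrite /cycle_rel eq_sym orbC. Qed.

Lemma cycle_irr m : irreflexive (@cycle_rel m).
Proof. by move=> i; rewrite /cycle_rel eqxx. Qed.

Definition path_graph (m : nat) : sgraph :=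
  SGraph (@path_sym m) (@path_irr m).
Definition cycle_graph (m : nat) : sgraph :=
  SGraph (@cycle_sym m) (@cycle_irr m).

Lemma path_bipartite m : bipartite (path_graph m).
Proof.
exists (fun i : 'I_m => odd i) => i j /= /orP[] /eqP <- /=;
by case: (odd _).
Qed.

Lemma even_cycle_bipartite m : bipartite (cycle_graph (2 * m)).
Proof.
have oddS r : odd (r.+1 %% (2 * m)) = ~~ odd r.
  by rewrite odd_mod // mul2n odd_double.
exists (fun i : 'I_(2 * m) => odd i) => i j /= /andP[_] /orP[] /eqP ->;
by rewrite oddS; case: (odd _).
Qed.

(* The path of order m, and the cycle of order 2 * m. *)
Definition pathB (m : nat) : bigraph := BiGraph (path_bipartite m).
Definition even_cycleB (m : nat) : bigraph := BiGraph (even_cycle_bipartite m).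

(* Main.v *)
Require Import Defs.
From mathcomp Require Import all_boot all_order all_algebra.
From mathcomp Require Import zify.

(** Both sides of K_{N,N}, with 2N <= 13n, are cut into the 13 residue classes
    modulo 13, and the classes are grouped into 13 "units" of at most n vertices:
    six on each side, made of the residues u and u + 6 for u < 6, and a mixed one
    made of the residue 12 of both sides.  The colouring depends only on the
    residues, and every connected component of a colour class has a unit, its hub,
    that meets all its edges.  A path of order 2(n + 1) contains n + 1 disjoint
    edges, so it does not fit in such a component.  The colouring was found by
    computer search. *)

(* The right unit {5, 11} is the only one whose two residues are coloured
   differently, as columns 5 and 7. *)
Definition row_of (a : nat) : nat :=
  nth 0 [:: 0; 1; 2; 3; 4; 5; 0; 1; 2; 3; 4; 5; 6] (a %% 13).

Definition col_of (b : nat) : nat :=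
  nth 0 [:: 0; 1; 2; 3; 4; 5; 0; 1; 2; 3; 4; 7; 6] (b %% 13).

(* Left units are numbered 0 to 5, the mixed unit is 6, and right units are
   numbered 7 to 12, so that row p belongs to unit p. *)
Definition col_unit (q : nat) : nat :=
  nth 0 [:: 7; 8; 9; 10; 11; 12; 6; 12] q.

Definition colour_table : seq (seq nat) :=
  [:: [:: 0; 1; 2; 4; 0; 3; 0; 3];
      [:: 2; 1; 0; 2; 4; 2; 3; 2];
      [:: 4; 3; 1; 0; 2; 1; 1; 1];
      [:: 1; 4; 4; 0; 2; 3; 4; 3];
      [:: 4; 0; 2; 1; 1; 0; 3; 0];
      [:: 1; 2; 3; 0; 3; 4; 2; 4];
      [:: 3; 1; 0; 3; 2; 4; 3; 4]].

(** Names the hub of the colour-[i] component through row [p]; with hubs tabulated, connectivity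
    needs only a check cell by cell. *)
Definition row_hub (i p : nat) : nat :=
  nth 0 (nth [::]
    [:: [:: 0; 9; 10; 10; 4; 10; 9];
        [:: 8; 8; 2; 7; 4; 7; 8];
        [:: 9; 1; 11; 11; 9; 5; 11];
        [:: 12; 6; 8; 12; 6; 5; 6];
        [:: 10; 1; 7; 3; 7; 12; 12]] i) p.

Definition col_hub (i q : nat) : nat :=
  nth 0 (nth [::]
    [:: [:: 0; 4; 9; 10; 0; 4; 0; 4];
        [:: 7; 8; 2; 4; 4; 2; 2; 2];
        [:: 1; 5; 9; 1; 11; 1; 5; 1];
        [:: 6; 8; 5; 6; 5; 12; 6; 12];
        [:: 7; 3; 3; 10; 1; 12; 3; 12]] i) q.

Definition cell_colour (p q : nat) : nat := nth 0 (nth [::] colour_table p) q.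

(** Inspection of all 56 cells. The equality keeps the hub constant along a colour component; the
    disjunction makes the hub meet every edge. *)
Lemma cell_colourP {p q : nat} : p < 7 -> q < 8 ->
  let i := cell_colour p q in
  [&& i < 5, row_hub i p == col_hub i q
    & (row_hub i p == p) || (row_hub i p == col_unit q)].
Proof.
by do 7?[case: p => [|p] //]; do 8?[case: q => [|q] //].
Qed.


Lemma row_of_lt (a : nat) : row_of a < 7.
Proof.
rewrite /row_of; move: (a %% 13) => r.
by do 13?[case: r => [|r] //]; rewrite /= nth_nil.
Qed.

Lemma col_of_lt (b : nat) : col_of b < 8.
Proof.
rewrite /col_of; move: (b %% 13) => r.
by do 13?[case: r => [|r] //]; rewrite /= nth_nil.
Qed.

(* A vertex of K_{N,N} is given by its side ([false] for left) and its index. *)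
Definition unit_of (u : bool * nat) : nat :=
  if u.1 then col_unit (col_of u.2) else row_of u.2.

Definition hub_of (i : nat) (u : bool * nat) : nat :=
  if u.1 then col_hub i (col_of u.2) else row_hub i (row_of u.2).

(* A unit consists of one residue class with [second_half] false and at most one
   with [second_half] true, the latter of residue at least 6: this makes
   2 * (a %/ 13) + second_half (s, a) smaller than n as soon as 2a + 2 <= 13n. *)
Definition second_half (u : bool * nat) : bool :=
  (6 <= u.2 %% 13) && (u.1 || (u.2 %% 13 != 12)).

Lemma unit_half_inj {u v : bool * nat} :
  unit_of u = unit_of v -> second_half u = second_half v ->
  u.1 = v.1 /\ u.2 = v.2 %[mod 13].
Proof.
pose res := allpairs pair [:: false; true] (iota 0 13).
(* Only side and residue matter, so comparing the 26 elements of [res] pairwise suffices. *)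
have chk : allrel (fun u v => (unit_of u == unit_of v) ==>
    (second_half u == second_half v) ==> (u == v)) res res by vm_compute.
have inres (w : bool * nat) : (w.1, w.2 %% 13) \in res.
  by apply/allpairsP; exists (w.1, w.2 %% 13); rewrite mem_iota ltn_mod; case: w.1.
have uE (w : bool * nat) : unit_of (w.1, w.2 %% 13) = unit_of w.
  by rewrite /unit_of /row_of /col_of /= modn_mod.
have hE (w : bool * nat) : second_half (w.1, w.2 %% 13) = second_half w.
  by rewrite /second_half /= modn_mod.
move=> eq_u eq_h; have := allrelP chk _ _ (inres u) (inres v).
by rewrite !uE !hE eq_u eq_h !eqxx /= => /eqP[-> ->].
Qed.

Definition side_index {N : nat} (u : 'I_N + 'I_N) : bool * nat :=
  match u with inl a => (false, val a) | inr b => (true, val b) end.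

Lemma side_index_inj (N : nat) : injective (@side_index N).
Proof. by move=> [a|a] [b|b] //= [] /val_inj ->. Qed.

(** [slot] injects the unit into ['I_n]: its parity gives the half, hence side and residue, and the
    rest gives the block of 13. *)
Lemma card_unit {n N : nat} (k : nat) : 2 * N <= 13 * n ->
  #|[set u : 'I_N + 'I_N | unit_of (side_index u) == k]| <= n.
Proof.
move=> leNn; pose U := [set u : 'I_N + 'I_N | unit_of (side_index u) == k].
pose slot (u : 'I_N + 'I_N) :=
  2 * ((side_index u).2 %/ 13) + second_half (side_index u).
have slot_lt u : slot u < n.
  have ltN : (side_index u).2 < N by case: u => a /=.
  rewrite /slot /second_half; have := divn_eq (side_index u).2 13.
  case: (leqP 6 ((side_index u).2 %% 13)) => /=; last lia.
  case: ((side_index u).1 || _) => /=; lia.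
rewrite -/U -[n]card_ord -(@card_in_imset _ _ (fun u => Ordinal (slot_lt u)) U).
  exact: max_card.
move=> u v; rewrite !inE => /eqP Uu /eqP Uv /(congr1 val) /=.
rewrite /slot => eq_slot; apply: side_index_inj.
have eq_h : second_half (side_index u) = second_half (side_index v).
  by move: eq_slot; case: (second_half _); case: (second_half _) => //=; lia.
have [eq1 eq2] := unit_half_inj (etrans Uu (esym Uv)) eq_h.
have eqd : (side_index u).2 %/ 13 = (side_index v).2 %/ 13.
  by move: eq_slot; rewrite eq_h; lia.
rewrite [LHS]surjective_pairing [RHS]surjective_pairing eq1; congr pair.
by rewrite (divn_eq (side_index u).2 13) eqd eq2 -divn_eq.
Qed.

Definition hub_colouring (N : nat) : edge_colouring 5 N :=
  [ffun ab : 'I_N * 'I_N => inord (cell_colour (row_of ab.1) (col_of ab.2))].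

Lemma hub_edge {N : nat} {i : 'I_5} {u v : 'I_N + 'I_N} :
  colour_class (hub_colouring N) i u v ->
  hub_of i (side_index u) = hub_of i (side_index v) /\
  (unit_of (side_index u) == hub_of i (side_index u)) ||
  (unit_of (side_index v) == hub_of i (side_index u)).
Proof.
have key (a b : 'I_N) : hub_colouring N (a, b) == i ->
    row_hub i (row_of a) = col_hub i (col_of b) /\
    (row_of a == row_hub i (row_of a)) ||
    (col_unit (col_of b) == row_hub i (row_of a)).
  rewrite ffunE /= => /eqP <-.
  have /and3P[lt5 /eqP eqh orh] := cell_colourP (row_of_lt a) (col_of_lt b).
  by rewrite inordK // ![_ == row_hub _ _]eq_sym.
case: u v => [a|b] [c|d] //= /key[]; rewrite /hub_of /unit_of //= => eqh orh.
by split=> //; rewrite -eqh orbC.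
Qed.

(** The edges joining positions [2 * j] and [2 * j + 1] form a matching; [g] picks an end of each
    lying in [U]. *)
Lemma matching_cover (T : finType) (n : nat) (f : 'I_(2 * n) -> T) (U : {set T}) :
  injective f ->
  (forall j k : 'I_(2 * n), k = j.+1 :> nat -> (f j \in U) || (f k \in U)) ->
  n <= #|U|.
Proof.
move=> f_inj fU.
have lt0 (j : 'I_n) : 2 * j < 2 * n by rewrite ltn_pmul2l.
have lt1 (j : 'I_n) : (2 * j).+1 < 2 * n by have := ltn_ord j; lia.
pose g j := if f (Ordinal (lt0 j)) \in U then Ordinal (lt0 j) else Ordinal (lt1 j).
have fgU j : f (g j) \in U.
  have := fU (Ordinal (lt0 j)) (Ordinal (lt1 j)) erefl.
  by rewrite /g; case: ifP.
have g_half j : (g j)./2 = j.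
  by rewrite /g; case: ifP => _ /=; rewrite mul2n ?uphalf_double ?doubleK.
rewrite -[n]card_ord -(card_imset _ (f := f \o g)).
  by apply: subset_leq_card; apply/subsetP => _ /imsetP[j _ ->]; apply: fgU.
move=> j k /f_inj eq_g; apply: val_inj.
by rewrite /= -(g_half j) eq_g g_half.
Qed.

Lemma path_not_forced (n N : nat) : 2 * N <= 13 * n ->
  ~~ forces_mono 5 (path_graph (2 * n.+1)) N.
Proof.
move=> leNn; apply/negP => /forallP/(_ (hub_colouring N)).
move=> /existsP[i /existsP[f /andP[/injectiveP f_inj /forallP f_edge]]].
have edgeP (j k : 'I_(2 * n.+1)) : k = j.+1 :> nat ->
    colour_class (hub_colouring N) i (f j) (f k).
  move=> eq_k; have /forallP/(_ k)/implyP := f_edge j.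
  by apply; rewrite /= /path_rel -eq_k eqxx.
pose hub j := hub_of i (side_index (f j)).
have hub_const (j : 'I_(2 * n.+1)) : hub j = hub ord0.
  case: j; elim=> [|j IHj] lt_j; first by congr hub; apply: val_inj.
  rewrite -(IHj (ltnW lt_j)) /hub.
  by have [<-] := hub_edge (edgeP (Ordinal (ltnW lt_j)) (Ordinal lt_j) erefl).
(* The common hub covers all edges of the path, so it would contain [n.+1] vertices. *)
have := card_unit (hub ord0) leNn; apply/negP; rewrite -ltnNge.
apply: matching_cover f_inj _ => j k /edgeP/hub_edge[_].
by rewrite !inE -/(hub j) hub_const.
Qed.

Lemma forces_mono_sub (k N : nat) (H H' : sgraph) (g : H' -> H) :
  injective g -> (forall x y, edge x y -> edge (g x) (g y)) ->
  forces_mono k H N -> forces_mono k H' N.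
Proof.
move=> g_inj g_edge /forallP forcedH; apply/forallP => c.
have /existsP[i /existsP[f /andP[/injectiveP f_inj /forallP f_edge]]] := forcedH c.
apply/existsP; exists i; apply/existsP; exists [ffun x => f (g x)].
apply/andP; split; first by apply/injectiveP => x y; rewrite !ffunE => /f_inj/g_inj.
apply/forallP => x; apply/forallP => y; apply/implyP => /g_edge.
by rewrite !ffunE; have /forallP/(_ (g y))/implyP := f_edge (g x).
Qed.

(** The path is a spanning subgraph of the cycle. *)
Lemma cycle_forces_path (k m N : nat) :
  forces_mono k (cycle_graph m) N -> forces_mono k (path_graph m) N.
Proof.
apply: (@forces_mono_sub _ _ _ _ (id : path_graph m -> cycle_graph m)) => // i j.
rewrite /= /path_rel /cycle_rel => /orP[] /eqP eq_ij.
  by rewrite eq_ij (modn_small (ltn_ord j)) eqxx /= andbT -val_eqE /= -eq_ij ltn_eqF.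
by rewrite eq_ij (modn_small (ltn_ord i)) eqxx orbT andbT -val_eqE /= -eq_ij gtn_eqF.
Qed.

Lemma bip_ramsey_forces (k : nat) (H : bigraph) : forces_mono k H (bip_ramsey k H).
Proof. by rewrite /bip_ramsey; case: ex_minnP. Qed.

Import Order.TTheory GRing.Theory Num.Theory.
Local Open Scope ring_scope.

Theorem theorem4 (n : nat) (hn : (1 <= n)%N) :
  (13%:R / 2%:R : rat) * n%:R < (bip_ramsey 5 (even_cycleB (n + 1)))%:R /\
  (13%:R / 2%:R : rat) * n%:R < (bip_ramsey 5 (pathB (2 * (n + 1))))%:R.
Proof.
(* Bounding every forcing [N] suffices, as the Ramsey number is itself forcing. *)
have bound (N : nat) : forces_mono 5 (path_graph (2 * (n + 1))) N ->
    (13%:R / 2%:R : rat) * n%:R < N%:R.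
  rewrite addn1 => forced; rewrite mulrAC ltr_pdivrMr // -!natrM ltr_nat.
  by rewrite ltnNge (mulnC N); apply: contraL forced; apply: path_not_forced.
split; apply: bound; last exact: bip_ramsey_forces.
exact/cycle_forces_path/bip_ramsey_forces.
Qed.
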